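(* Let $f\colon\mathbb{R}\to\mathbb{R}_{>0}$ and $g\colon\mathbb{R}\to\mathbb{R}_{>0}$ be functions with $g(x)=o(\log\log x)$ as $x\to\infty$. Then there exists a graph $G$ such that \[ {\rm tw}(G) > {\rm tree}\text{-}\alpha(G)\cdot f({\rm tree}\text{-}\chi(G))\cdot g({\rm tw}(G)). \]
   Context: A tree-decomposition of a graph $G$ is a pair $(T,\{X_t\}_{t\in V(T)})$ where $T$ is a tree and $X_t\subseteq V(G)$, such that every edge of $G$ has both ends in some $X_t$ and for every vertex $v$ the nodes $t$ with $v\in X_t$ induce a non-empty connected subtree of $T$. ${\rm tw}(G)$ is the minimum over tree-decompositions of $\max_t|X_t|-1$. ${\rm tree}\text{-}\alpha(G)$ (resp. ${\rm tree}\text{-}\chi(G)$) is the minimum over tree-decompositions of $G$ of $\max_t\alpha(G[X_t])$ (resp. $\max_t\chi(G[X_t])$), where $\alpha$ is the independence number and $\chi$ the chromatic number. *)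

(* Defs.v *)
From mathcomp Require Import all_boot all_order all_algebra.
From mathcomp Require Import boolp filter normedtype.

Set Implicit Arguments.
Unset Strict Implicit.
Unset Printing Implicit Defensive.


Record sgraph := SGraph {
  vertex :> finType;
  edge : rel vertex;
  edge_sym : symmetric edge;
  edge_irr : irreflexive edge }.

Section Induced.
Variables (G : sgraph) (A : {set G}).

Definition induced_edge : rel {x : G | x \in A} :=
  [rel x y | edge (val x) (val y)].

Lemma induced_edge_sym : symmetric induced_edge.
Proof. by move=> x y; apply: edge_sym. Qed.

Lemma induced_edge_irr : irreflexive induced_edge.
Proof. by move=> x; apply: edge_irr. Qed.

Definition induced : sgraph := SGraph induced_edge_sym induced_edge_irr.
End Induced.

(* The graph with no vertices is not connected. *)
Definition connected (G : sgraph) : Prop :=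
  0 < #|G| /\ forall x y : G, connect (@edge G) x y.

(* [ucycle edge [:: x; y]] holds for every edge xy, so only the sequences of
   length at least 3 represent cycles of the graph. *)
Definition acyclic (G : sgraph) : Prop :=
  forall c : seq G, 2 < size c -> ~ ucycle (@edge G) c.

Definition is_tree (T : sgraph) : Prop := connected T /\ acyclic T.

Definition independent (G : sgraph) (S : {set G}) : bool :=
  [forall x in S, forall y in S, ~~ edge x y].

Definition alpha (G : sgraph) : nat :=
  \max_(S : {set G} | independent S) #|S|.

Definition colorable (G : sgraph) (k : nat) : bool :=
  [exists c : {ffun G -> 'I_k}, forall x, forall y, edge x y ==> (c x != c y)].

Lemma colorable_ex (G : sgraph) : exists k, colorable G k.
Proof.
exists #|G|; apply/existsP; exists [ffun x => enum_rank x].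
apply/forallP=> x; apply/forallP=> y; apply/implyP=> xy.
rewrite !ffunE (inj_eq enum_rank_inj).
by apply: contraTneq xy => ->; rewrite edge_irr.
Qed.

Definition chi (G : sgraph) : nat := ex_minn (colorable_ex G).


Record tree_decomposition (G : sgraph) := TreeDecomposition {
  td_tree : sgraph;
  td_bag : td_tree -> {set G};
  td_treeP : is_tree td_tree;
  td_edgeP : forall x y : G, edge x y ->
    exists t : td_tree, (x \in td_bag t) && (y \in td_bag t);
  td_vertexP : forall v : G, connected (induced [set t | v \in td_bag t]) }.

Definition td_max (G : sgraph) (p : {set G} -> nat)
    (D : tree_decomposition G) : nat :=
  \max_(t : td_tree D) p (td_bag t).

Section Trivial.
Variable G : sgraph.

Lemma unit_edge_sym : symmetric (fun _ _ : unit => false).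
Proof. by []. Qed.

Lemma unit_edge_irr : irreflexive (fun _ _ : unit => false).
Proof. by []. Qed.

Definition unit_graph : sgraph := SGraph unit_edge_sym unit_edge_irr.

Lemma unit_graph_tree : is_tree unit_graph.
Proof.
split; first by split=> [|[] []]; rewrite ?card_unit ?connect0.
by move=> [|[] [|[] c]] // _; rewrite /ucycle /= andbF.
Qed.

Lemma trivial_edgeP (x y : G) : edge x y ->
  exists t : unit_graph, (x \in [set: G]) && (y \in [set: G]).
Proof. by move=> _; exists tt; rewrite !inE. Qed.

Lemma trivial_vertexP (v : G) :
  connected (induced [set t : unit_graph | v \in [set: G]]).
Proof.
split; last first.
  move=> [[] hx] [[] hy]; suff -> : hx = hy by apply: connect0.
  exact: bool_irrelevance.
have t0 : tt \in [set t : unit_graph | v \in [set: G]] by rewrite !inE.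
by apply/card_gt0P; exists (exist (fun t => t \in [set t : unit_graph | v \in [set: G]]) tt t0).
Qed.

Definition trivial_decomposition : tree_decomposition G :=
  @TreeDecomposition G unit_graph (fun=> [set: G])
    unit_graph_tree trivial_edgeP trivial_vertexP.
End Trivial.

Lemma td_max_ex (G : sgraph) (p : {set G} -> nat) :
  exists k, `[< exists D : tree_decomposition G, td_max p D = k >].
Proof.
by exists (td_max p (trivial_decomposition G)); apply/asboolP; eexists.
Qed.

(* The minimum over all tree-decompositions of G of the maximum of p over the
   bags. *)
Definition td_min (G : sgraph) (p : {set G} -> nat) : nat :=
  ex_minn (td_max_ex p).

(* An integer, so that the subtraction is not truncated: the graph with no
   vertices has treewidth -1. *)
Definition tw (G : sgraph) : int :=
  ((td_min (fun X : {set G} => #|X|))%:Z - 1)%R.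

Definition tree_alpha (G : sgraph) : nat :=
  td_min (fun X : {set G} => alpha (induced X)).

Definition tree_chi (G : sgraph) : nat :=
  td_min (fun X : {set G} => chi (induced X)).

(* The notation [_ =o_ F _] requires a canonical filter structure on F, and
   the library declares none for the filter +oo. *)
Canonical pinfty_filter_on (R : numFieldType) : filter_on R :=
  FilterType (pinfty_nbhs R) _.

(* Main.v *)
Require Import Defs.
From mathcomp Require Import all_boot all_order all_algebra.
From mathcomp Require Import boolp ring.

Set Implicit Arguments.
Unset Strict Implicit.
Unset Printing Implicit Defensive.

(* The graph is the join of a Burling-type graph H (after Walczak's
   triangle-free graphs without large independent sets) with an independent set
   of |H| vertices. Every vertex of the join has degree at least |H|, so its
   treewidth is |H|; the star-decomposition whose bags are V(H) and V(H) plus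
   one further vertex gives tree-alpha at most alpha(H); adding the independent
   set to all bags of a decomposition of H with bipartite bags gives tree-chi at
   most 3.

   H is built in k steps together with a family of p = 2^(2^k - 1) independent
   probes, each contained in a bag of a decomposition with bipartite bags. A
   step takes p main and p secondary copies of H and adds an apex (s, q) joined
   to the probe q of the s-th secondary copy; each pair (s, q) yields two new
   probes, the probe s of the q-th main copy together with either the probe q of
   the s-th secondary copy or the apex. An independent set I cannot contain the
   apex and meet its neighbourhood, so the number of new probes of (s, q) that I
   meets is at least [I meets s] + [I meets q] + [the apex is in I]. Summing, an
   independent set has at most as many vertices as it meets probes; hence
   alpha(H) <= p, whereas |H| = (1 + k/2) p and ln ln |H| = O(k). *)

(** * Trees presented by a parent map *)

Lemma connect_induced (G : sgraph) (A : {set G}) (x y : induced A) :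
  connect (@edge (induced A)) x y -> connect (@edge G) (val x) (val y).
Proof.
move=> /connectP[p + ->]; elim: p x => //= a p IHp x /andP[xa /IHp].
exact/connect_trans/connect1.
Qed.

(** A depth that drops along [parent] yields connectedness and acyclicity once and for all, so each
    decomposition below only has to supply a parent map and a depth. *)
Record rooted_tree := RootedTree {
  node :> finType;
  tree_root : node;
  parent : node -> node;
  depth : node -> nat;
  depth_parent : forall x, x != tree_root -> depth (parent x) < depth x }.
Arguments tree_root {_}.

Section RootedTree.
Variable T : rooted_tree.

Definition tree_edge : rel T :=
  [rel x y | (x != tree_root) && (parent x == y) ||
             (y != tree_root) && (parent y == x)].

Lemma tree_edge_sym : symmetric tree_edge.
Proof. by move=> x y; rewrite /tree_edge /= orbC. Qed.

Lemma tree_edge_irr : irreflexive tree_edge.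
Proof.
move=> x; rewrite /tree_edge /= orbb; apply/negP => /andP[/depth_parent + /eqP].
by move=> /[swap] ->; rewrite ltnn.
Qed.

Definition tree_graph := SGraph tree_edge_sym tree_edge_irr.

Lemma tree_edge_parent (x y : T) :
  tree_edge x y -> depth y <= depth x -> y = parent x.
Proof.
case/orP=> /andP[zr /eqP <- //]; move/depth_parent: zr.
by rewrite ltnNge => /negP.
Qed.

(** At a deepest vertex of a cycle, both neighbours on the cycle have no greater depth, so both are
    its parent; this contradicts uniqueness. *)
Lemma tree_graph_acyclic : acyclic tree_graph.
Proof.
move=> c c3 /andP[]; case: c c3 => // x0 c0; set c := x0 :: c0 => c3 cyc un.
have x0c : x0 \in c by rewrite mem_head.
have [x xc xmax] := @arg_maxnP _ x0 (mem c) (@depth T) x0c.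
have [i s def_c] := rot_to xc.
have {}cyc : cycle tree_edge (x :: s) by rewrite -def_c rot_cycle.
have {}un : uniq (x :: s) by rewrite -def_c rot_uniq.
have {}c3 : 2 < size (x :: s) by rewrite -def_c size_rot.
have {}xmax y : y \in x :: s -> depth y <= depth x.
  by rewrite -def_c mem_rot => /xmax.
case: s {def_c} cyc un c3 xmax => [|y [|z s]] // cyc un _ xmax.
move: cyc; rewrite /= rcons_path /= => /and4P[xy _ _].
have lz : last z s \in z :: s by rewrite mem_last.
rewrite tree_edge_sym => /tree_edge_parent l_x.
have {}l_x : last z s = parent x.
  by apply/l_x/xmax; rewrite inE mem_behead ?orbT.
have y_x : y = parent x.
  by apply: tree_edge_parent xy (xmax y _); rewrite !inE eqxx orbT.
by move: un; rewrite /= => /and3P[_ + _]; rewrite y_x -l_x lz.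
Qed.

(** Following parents inside [A] lowers the depth and can stop only at [a]. *)
Lemma connected_upclosed (A : {set T}) (a : T) : a \in A ->
    (forall t, t \in A -> t != a -> (t != tree_root) && (parent t \in A)) ->
  Defs.connected (induced (A : {set tree_graph})).
Proof.
move=> aA upA; pose a' : induced (A : {set tree_graph}) := exist _ a aA.
split; first by apply/card_gt0P; exists a'.
have sym : connect_sym (@edge (induced (A : {set tree_graph}))).
  by apply/sym_connect_sym/edge_sym.
suff conn_a x : connect (@edge (induced (A : {set tree_graph}))) x a'.
  by move=> x y; apply: connect_trans (conn_a x) _; rewrite sym.
move: {2}(depth _) (leqnn (depth (val x))) => n.
elim: n x => [|n IHn] [t tA] /= t_n.
all: have [ta|t_a] := eqVneq t a;
  first by (rewrite (_ : exist _ _ _ = a') ?connect0 //; apply: val_inj).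
all: have /andP[tr pA] := upA t tA t_a; have pt := depth_parent tr.
  by have := leq_trans pt t_n.
apply: connect_trans (IHn (exist _ (parent t) pA) (leq_trans pt t_n)).
by apply/connect1/orP; left; apply/andP; split; [exact: tr|exact: eqxx].
Qed.

Lemma tree_graphP : is_tree tree_graph.
Proof.
split; last exact: tree_graph_acyclic.
have [|_ conn] := @connected_upclosed setT tree_root (in_setT _).
  by move=> t _ ->; rewrite in_setT.
split=> [|x y]; first by apply/card_gt0P; exists tree_root.
have xT : x \in [set: tree_graph] by rewrite in_setT.
have yT : y \in [set: tree_graph] by rewrite in_setT.
exact: connect_induced (conn (exist _ x xT) (exist _ y yT)).
Qed.
End RootedTree.

(** * Rooted tree-decompositions and bounds on bag parameters *)

Record rooted_dec (G : sgraph) := RootedDec {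
  rd_tree :> rooted_tree;
  rd_bag : rd_tree -> {set G};
  rd_edge : forall x y : G, edge x y ->
    exists t, (x \in rd_bag t) && (y \in rd_bag t);
  rd_top : G -> rd_tree;
  rd_top_bag : forall v, v \in rd_bag (rd_top v);
  rd_parent_bag : forall v t, v \in rd_bag t -> t != rd_top v ->
    (t != tree_root) && (v \in rd_bag (parent t)) }.
Arguments rd_bag {G r}.

(** By [rd_parent_bag], the nodes whose bags contain [v] are closed under parents except at
    [rd_top v], hence form a subtree rooted there. *)
Lemma rooted_dec_vertex (G : sgraph) (D : rooted_dec G) (v : G) :
  Defs.connected (induced [set t : tree_graph D | v \in rd_bag t]).
Proof.
apply: (@connected_upclosed D _ (rd_top D v)) => [|t]; rewrite !inE.
  exact: rd_top_bag.
exact: rd_parent_bag.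
Qed.

Definition dec_of_rooted (G : sgraph) (D : rooted_dec G) :=
  @TreeDecomposition G (tree_graph D) rd_bag (tree_graphP D) (@rd_edge G D)
    (rooted_dec_vertex D).

Lemma td_min_le (G : sgraph) (p : {set G} -> nat) (D : rooted_dec G) m :
  (forall t : D, p (rd_bag t) <= m) -> td_min p <= m.
Proof.
move=> p_m; rewrite /td_min; case: ex_minnP => k _ k_min.
apply: (@leq_trans (td_max p (dec_of_rooted D))).
  by apply: k_min; apply/asboolP; exists (dec_of_rooted D).
by apply/bigmax_leqP => t _; apply: p_m.
Qed.

Lemma td_min_ge (G : sgraph) (p : {set G} -> nat) m :
  (forall D : tree_decomposition G, exists t : td_tree D, m <= p (td_bag t)) ->
  m <= td_min p.
Proof.
move=> m_p; rewrite /td_min; case: ex_minnP => k /asboolP[D <-] _.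
by have [t /leq_trans] := m_p D; apply; apply: leq_bigmax.
Qed.

Lemma alpha_induced_le (G : sgraph) (X : {set G}) m :
  (forall I : {set G}, I \subset X -> independent I -> #|I| <= m) ->
  alpha (induced X) <= m.
Proof.
move=> I_m; apply/bigmax_leqP => J indJ.
rewrite -(card_imset _ val_inj); apply: I_m.
  by apply/subsetP => _ /imsetP[x _ ->]; apply: valP.
apply/forall_inP => _ /imsetP[x xJ ->]; apply/forall_inP => _ /imsetP[y yJ ->].
by move/forall_inP: indJ => /(_ x xJ) /forall_inP /(_ y yJ).
Qed.

Lemma chi_induced_le (G : sgraph) (X : {set G}) m (c : G -> 'I_m) :
  (forall x y, x \in X -> y \in X -> edge x y -> c x != c y) ->
  chi (induced X) <= m.
Proof.
move=> c_proper; rewrite /chi; case: ex_minnP => k _; apply.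
apply/existsP; exists [ffun x => c (val x)].
apply/forallP => x; apply/forallP => y; apply/implyP => xy.
by rewrite !ffunE c_proper // ?(valP x) ?(valP y).
Qed.

(** * Minimum degree as a lower bound on treewidth *)

Section Components.
Variable T : sgraph.
Hypothesis treeT : is_tree T.

(** For [y != x], [connect (avoid x) y] describes the component of [T - x] that contains [y],
    without passing to a subtype. *)
Definition avoid (x : T) : rel T := [rel a b | [&& edge a b, a != x & b != x]].

Lemma connect_avoid_neq (x y z : T) : y != x -> connect (avoid x) y z -> z != x.
Proof.
move=> yx /connectP[p + ->]; elim: p y yx => //= a p IHp y _.
by move=> /andP[/and3P[_ _ ax]]; apply: IHp.
Qed.

(** A path between two neighbours of [x] that avoids [x] would close up to a cycle through [x]. *)
Lemma neighbours_separated (x y z : T) :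
  edge x y -> edge x z -> y != z -> ~~ connect (avoid x) y z.
Proof.
move=> xy xz yz; apply/negP.
move=> /connectP[p0 /shortenP[p p_path p_uniq _] z_last].
apply: (treeT.2 [:: x, y & p]).
  by case: p z_last {p_path p_uniq} => // zy; rewrite zy eqxx in yz.
have yx : y != x by apply: contraTneq xy => ->; rewrite edge_irr.
rewrite /ucycle cons_uniq p_uniq andbT /= xy rcons_path -z_last.
rewrite [edge z x]edge_sym xz andbT (sub_path _ p_path) /=;
  last by move=> a b /and3P[].
apply/negP => xyp; suff: x != x by rewrite eqxx.
by apply: (connect_avoid_neq yx); apply: (path_connect p_path).
Qed.

(** Since [x] and [z] are distinct neighbours of [y], paths from [z] that avoid [y] also avoid [x].
    The inclusion is proper because [y] is lost. *)
Lemma component_shrink (x y z : T) : edge x y -> edge y z -> z != x ->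
  [set w | connect (avoid y) z w] \proper [set w | connect (avoid x) y w].
Proof.
move=> xy yz zx.
have yx : y != x by apply: contraTneq xy => ->; rewrite edge_irr.
have zy : z != y by apply: contraTneq yz => ->; rewrite edge_irr.
have sep : ~~ connect (avoid y) z x.
  by apply: neighbours_separated; rewrite // edge_sym.
apply/properP; split; last first.
  exists y; rewrite inE ?connect0 //.
  by apply/negP => /(connect_avoid_neq zy); rewrite eqxx.
apply/subsetP => w; rewrite !inE => /connectP[p p_path ->].
apply: (@connect_trans _ _ z).
  by apply: connect1; rewrite /avoid /= yz yx zx.
apply/connectP; exists p => //.
have p_x a : a \in z :: p -> a != x.
  by move=> /(path_connect p_path); apply: contraTneq => ->.
elim: p z {yz zx zy sep} p_path p_x => //= a p IHp z.
move=> /andP[/and3P[za _ _] p_path] p_x.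
rewrite /avoid /= za !p_x ?inE ?eqxx ?orbT //= IHp // => b bp.
by rewrite p_x // inE bp orbT.
Qed.

Lemma component_step (x y w : T) :
  edge x y -> connect (avoid x) y w -> w != y ->
  exists z, [/\ edge y z, z != x & connect (avoid y) z w].
Proof.
move=> xy /connectP[p0 /shortenP[[|z p] p_path p_uniq _] ->];
  rewrite /= ?eqxx //.
move: p_path p_uniq => /= /andP[/and3P[yz yx zx] p_path] /andP[yzp _] _.
exists z; split => //; apply/connectP; exists p => //.
elim: p z {yz zx} p_path yzp => //= a p IHp z /andP[/and3P[za _ _] p_path].
rewrite !inE !negb_or => /and3P[yz ya yp].
by rewrite /avoid /= za eq_sym yz eq_sym ya /= IHp // inE negb_or ya.
Qed.

Lemma connected_component (A : {set T}) (x y z : T) :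
  Defs.connected (induced A) ->
  x \notin A -> y \in A -> z \in A -> connect (avoid x) y z.
Proof.
move=> [_ conn] xA yA zA.
have /connectP[p p_path /(congr1 val) /= ->] :=
  conn (exist _ y yA) (exist _ z zA).
rewrite -[y in connect _ y]/(val (exist (fun t => t \in A) y yA)).
have neq (u : induced A) : val u != x by apply: contraTneq (valP u) => ->.
elim: p (exist _ y yA : induced A) p_path => [|a p IHp] b /=.
  by rewrite connect0.
move=> /andP[ba /IHp]; apply/connect_trans/connect1.
by rewrite /avoid /= !neq andbT [edge _ _]ba.
Qed.
End Components.

(* Among the components of T - x, over all x, that contain the whole subtree
   of some vertex v, a minimal one is attached to x by a node y whose bag
   contains the closed neighbourhood of v. *)
Lemma closed_nbhd_in_bag (G : sgraph) (D : tree_decomposition G) : 0 < #|G| ->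
  exists v (t : td_tree D),
    v \in td_bag t /\ forall u, edge v u -> u \in td_bag t.
Proof.
move=> /card_gt0P[v0 _]; have treeT := td_treeP D.
have sub v : exists t : td_tree D, v \in td_bag t.
  have [/card_gt0P[[t tv] _] _] := td_vertexP D v.
  by exists t; rewrite inE in tv.
have comp v (x y z : td_tree D) : v \notin td_bag x -> v \in td_bag y ->
    v \in td_bag z -> connect (avoid x) y z.
  move=> vx vy vz.
  by apply: (connected_component (td_vertexP D v)); rewrite inE.
(* The component of [T - xy.1] at its neighbour [xy.2] contains every node whose bag contains
   [v]. *)
pose good (xy : td_tree D * td_tree D) (v : G) := edge xy.1 xy.2 &&
  [forall t : td_tree D, (v \in td_bag t) ==> connect (avoid xy.1) xy.2 t].
have [] := pselect (exists xy v, good xy v); last first.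
  (* Without good pairs, the bag of [y] contains all vertices: for a missing [u], the first edge of
     a path from [y] to the subtree of [u] would be a good pair. *)
  move=> none; have [y vy] := sub v0; exists v0, y; split=> // u _.
  apply: contrapT => /negP uy; apply: none.
  have [w uw] := sub u.
  have wy : w != y by apply: contraNneq uy => <-.
  have /connectP[p0 /shortenP[[|z p] p_path p_uniq _] w_last] := treeT.1.2 y w.
    by rewrite w_last /= eqxx in wy.
  exists (y, z), u; rewrite /good /=; move: p_path => /= /andP[yz p_path].
  rewrite yz; apply/forallP => t; apply/implyP => ut.
  apply: connect_trans (comp u y w t uy uw ut).
  apply/connectP; exists p => //; move: p_uniq => /= /andP[yzp _].
  elim: p z {yz w_last} p_path yzp => //= a p IHp z /andP[za p_path].
  rewrite !inE !negb_or => /and3P[yz ya yp].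
  by rewrite /avoid /= za eq_sym yz eq_sym ya /= IHp // inE negb_or ya.
move=> [xy0 [v1 good0]].
pose size_xy (xy : td_tree D * td_tree D) :=
  #|[set w | connect (avoid xy.1) xy.2 w]|.
pose isgood xy := [exists v, good xy v].
have isgood0 : isgood xy0 by apply/existsP; exists v1.
have [[x y] /existsP[v /andP[/= xy /forallP vsub]] ymin] :=
  @arg_minnP _ xy0 isgood size_xy isgood0.
(* If [u] were missing at [y], its subtree would lie in a component of [T - y] at a neighbour
   [z != x], a good pair with a smaller component. *)
have {}ymin u w : connect (avoid x) y w -> u \in td_bag w -> u \in td_bag y.
  move=> yw uw; apply: contrapT => /negP uy.
  have wy : w != y by apply: contraNneq uy => <-.
  have [z [yz zx zw]] := component_step xy yw wy.
  have: isgood (y, z).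
    apply/existsP; exists u; rewrite /good /= yz; apply/forallP => t.
    apply/implyP => ut; apply: connect_trans zw _; exact: (comp u).
  move/ymin; rewrite leqNgt; case/negP.
  exact/proper_card/component_shrink.
have [w vw] := sub v; exists v, y; split=> [|u vu].
  by apply: (ymin v w) => //; apply: (implyP (vsub w)).
have [t /andP[vt ut]] := td_edgeP D vu.
by apply: (ymin u t) => //; apply: (implyP (vsub t)).
Qed.

(** Some bag contains a closed neighbourhood, which has at least [d + 1] elements. As this [td_min]
    is the treewidth plus one, the treewidth is at least [d]. *)
Lemma min_degree_td_min (G : sgraph) d : 0 < #|G| ->
  (forall v : G, d <= #|[set u | edge v u]|) ->
  d < td_min (fun X : {set G} => #|X|).
Proof.
move=> G_gt0 deg; apply: td_min_ge => D.
have [v [t [vt nbt]]] := closed_nbhd_in_bag D G_gt0; exists t.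
apply: leq_trans (_ : #|v |: [set u | edge v u]| <= _).
  by rewrite cardsU1 inE edge_irr; apply: deg.
by apply/subset_leq_card/subsetP => u; rewrite !inE => /predU1P[->|/nbt].
Qed.

(** * The invariant and one step of the Burling-type construction *)

(** The invariant of the induction. Counting only the probes that [I] meets makes [probe_hits]
    strong enough to be inherited; [home s] is the node at which further trees are attached. *)
Record burling_graph := BurlingGraph {
  bgraph :> sgraph;
  probe_index : finType;
  probe : probe_index -> {set bgraph};
  probe_independent : forall s, independent (probe s);
  probe_hits : forall I : {set bgraph}, independent I ->
    #|I| <= #|[set s | probe s :&: I != set0]|;
  bdec : rooted_dec bgraph;
  bdec_bipartite : forall t : bdec, exists c : bgraph -> bool,
    forall x y, x \in rd_bag t -> y \in rd_bag t -> edge x y -> c x != c y;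
  home : probe_index -> bdec;
  probe_home : forall s, probe s \subset rd_bag (home s) }.
Arguments probe {b}.
Arguments home {b}.

Lemma independentP (G : sgraph) (I : {set G}) :
  reflect {in I &, forall x y, ~~ edge x y} (independent I).
Proof.
apply: (iffP forall_inP) => [ind x y xI | ind x xI].
  by move: y; apply/forall_inP/ind.
by apply/forall_inP => y; apply: ind.
Qed.

Section BurlingStep.
Variable B : burling_graph.
Let P := probe_index B.
Let T := rd_tree (bdec B).

(* The vertices are [inl (inl (q, v))], the copy of [v] in the q-th main copy
   of [B], [inl (inr (s, v))], the copy of [v] in the s-th secondary copy, and
   the apex [inr (s, q)], joined to the probe [q] of the s-th secondary copy. *)
Definition step_vertex := (P * B + P * B + P * P)%type.

Definition step_edge : rel step_vertex := fun x y =>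
  match x, y with
  | inl (inl (q, u)), inl (inl (r, v)) => (q == r) && edge u v
  | inl (inr (s, u)), inl (inr (r, v)) => (s == r) && edge u v
  | inl (inr (s, u)), inr (r, q) => (s == r) && (u \in probe q)
  | inr (r, q), inl (inr (s, u)) => (s == r) && (u \in probe q)
  | _, _ => false
  end.

Lemma step_edge_sym : symmetric step_edge.
Proof.
by move=> [[[q u]|[s u]]|[s q]] [[[r v]|[r v]]|[r o]] //=;
   rewrite eq_sym edge_sym.
Qed.

Lemma step_edge_irr : irreflexive step_edge.
Proof. by move=> [[[q u]|[s u]]|[s q]] //=; rewrite edge_irr andbF. Qed.

Definition step_graph := SGraph step_edge_sym step_edge_irr.

Definition step_probe (i : P * P * bool) : {set step_graph} :=
  let: (s, q, b) := i in
  [set x : step_vertex | match x with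
   | inl (inl (r, v)) => (r == q) && (v \in probe s)
   | inl (inr (r, v)) => [&& ~~ b, r == s & v \in probe q]
   | inr sq => b && (sq == (s, q))
   end].

Lemma step_probe_independent i : independent (step_probe i).
Proof.
case: i => [[s q] b]; apply/independentP => x y.
rewrite !inE; case: x y => [[[r u]|[r u]]|[r o]] [[[r' v]|[r' v]]|[r' o']] //=.
- move=> /andP[_ us] /andP[_ vs]; apply/nandP; right.
  exact: (independentP _ (probe_independent s)) us vs.
- move=> /and3P[_ _ us] /and3P[_ _ vs]; apply/nandP; right.
  exact: (independentP _ (probe_independent q)) us vs.
- by case: b.
- by case: b.
Qed.

Lemma step_probe_hits (I : {set step_graph}) : independent I ->
  #|I| <= #|[set i | step_probe i :&: I != set0]|.
Proof.
move=> indI.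
pose main q := [set v | (inl (inl (q, v)) : step_graph) \in I].
pose secondary s := [set v | (inl (inr (s, v)) : step_graph) \in I].
have ind_main q : independent (main q).
  apply/independentP => u v; rewrite !inE => uI vI.
  by have := independentP _ indI _ _ uI vI; rewrite /= eqxx.
have ind_secondary s : independent (secondary s).
  apply/independentP => u v; rewrite !inE => uI vI.
  by have := independentP _ indI _ _ uI vI; rewrite /= eqxx.
have card_sum (A : finType) (X : {set A}) : #|X| = \sum_a (a \in X : nat).
  by rewrite -sum1_card big_mkcond; apply: eq_bigr => a _; case: (a \in X).
have cardI : #|I| = \sum_q #|main q| + \sum_s #|secondary s| +
    \sum_s \sum_q ((inr (s, q) : step_graph) \in I : nat).
  rewrite card_sum big_sumType big_sumType /= !pair_bigA /=.
  congr (_ + _ + _); last by apply: eq_bigr => -[].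
  - under [RHS]eq_bigr do rewrite card_sum.
    by rewrite pair_bigA; apply: eq_bigr => -[q v] _; rewrite inE.
  - under [RHS]eq_bigr do rewrite card_sum.
    by rewrite pair_bigA; apply: eq_bigr => -[q v] _; rewrite inE.
pose hit (X Y : {set B}) : nat := X :&: Y != set0.
have sum_hit (X : {set B}) : independent X -> #|X| <= \sum_s hit (probe s) X.
  move=> /probe_hits /leq_trans; apply; rewrite card_sum.
  by apply: leq_sum => s _; rewrite inE.
(* The invariant is applied in each copy, and the sums are exchanged so that all three contributions
   are indexed by pairs [(s, q)]. *)
have main_hits : \sum_q #|main q| <= \sum_s \sum_q hit (probe s) (main q).
  by rewrite exchange_big; apply: leq_sum => q _; apply: sum_hit.
have secondary_hits :
    \sum_s #|secondary s| <= \sum_s \sum_q hit (probe q) (secondary s).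
  by apply: leq_sum => s _; apply: sum_hit.
rewrite cardI; apply: leq_trans (leq_add (leq_add main_hits secondary_hits)
  (leqnn _)) _.
have -> : #|[set i | step_probe i :&: I != set0]| =
    \sum_s \sum_q \sum_b (step_probe (s, q, b) :&: I != set0 : nat).
  rewrite card_sum !pair_bigA.
  by apply: eq_bigr => -[[s q] b] _; rewrite inE.
rewrite -!big_split /=; apply: leq_sum => s _.
rewrite -!big_split /=; apply: leq_sum => q _.
rewrite big_bool /= /hit.
have hitP (i : P * P * bool) x :
    x \in step_probe i -> x \in I -> step_probe i :&: I != set0.
  by move=> xi xI; apply/set0Pn; exists x; rewrite inE xi.
have main_hit : probe s :&: main q != set0 ->
    (step_probe (s, q, true) :&: I != set0) /\
    (step_probe (s, q, false) :&: I != set0).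
  case/set0Pn=> v; rewrite !inE => /andP[vs vI].
  by split; apply: (hitP _ (inl (inl (q, v)))); rewrite // inE eqxx.
have secondary_hit : probe q :&: secondary s != set0 ->
    (step_probe (s, q, false) :&: I != set0) /\
    (inr (s, q) : step_graph) \notin I.
  case/set0Pn=> v; rewrite !inE => /andP[vq vI]; split.
    by apply: (hitP _ (inl (inr (s, v)))); rewrite // inE eqxx.
  apply/negP => sqI; have := independentP _ indI _ _ vI sqI.
  by rewrite /= eqxx vq.
have apex_hit : (inr (s, q) : step_graph) \in I ->
    step_probe (s, q, true) :&: I != set0.
  by move=> sqI; apply: hitP sqI; rewrite inE eqxx.
(* At most one of the secondary copy and the apex contributes. If the main copy contributes, both
   new probes are met, which pays for a total of 2. Otherwise the secondary contribution is paid by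
   the probe flagged [false], that of the apex by the one flagged [true]. *)
case: (probe s :&: main q =P set0) main_hit => [_ _|_ [//|-> ->]];
case: (probe q :&: secondary s =P set0) secondary_hit => [_ _|_ [//|q_hit]] //.
- by case: (_ \in I) apex_hit => // ->.
- by move=> /negPf ->; rewrite q_hit leq_addl.
- by case: (inr _ \in I).
- by move=> /negPf ->.
Qed.

(** * The decomposition of the step graph with bipartite bags *)

Definition step_node := (T + P * T + P * P)%type.

(** All main copies share one tree. The tree of the secondary copy [s] hangs from [home s] in it,
    and the leaf of the apex [(s, q)] hangs from [home q] in that secondary tree. *)
Definition step_parent (x : step_node) : step_node :=
  match x with
  | inl (inl t) => inl (inl (parent t))
  | inl (inr (s, t)) =>
      if t == tree_root then inl (inl (home s)) else inl (inr (s, parent t))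
  | inr (s, q) => inl (inr (s, home q))
  end.

(** The offset [m] places every secondary node below the whole main tree, and every leaf below all
    secondary trees, wherever they are attached. *)
Definition step_depth (x : step_node) : nat :=
  let m := \max_(t : T) depth t in
  match x with
  | inl (inl t) => depth t
  | inl (inr (s, t)) => (m + depth t).+1
  | inr (s, q) => (m + m).+2
  end.

Lemma step_depth_parent (x : step_node) : x != inl (inl tree_root) ->
  step_depth (step_parent x) < step_depth x.
Proof.
case: x => [[t|[s t]]|[s q]] /=.
- by move=> tr; apply: depth_parent; apply: contraNneq tr => ->.
- move=> _; case: eqVneq => [_|tr] /=.
    by rewrite ltnS; apply: leq_trans (leq_addr _ _); apply: leq_bigmax.
  by rewrite ltnS ltn_add2l depth_parent.
- by move=> _; rewrite !ltnS leq_add2l; apply: leq_bigmax.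
Qed.

Definition step_tree := RootedTree step_depth_parent.

(** The secondary tree of [s] carries the probe [s] of all main copies down to the leaves, so the
    leaf [(s, q)] contains both new probes of that pair and becomes their home. *)
Definition step_bag (x : step_tree) : {set step_graph} :=
  [set y : step_vertex | match (x : step_node), y with
   | inl (inl t), inl (inl (_, v)) => v \in rd_bag t
   | inl (inr (s, t)), inl (inl (_, v)) => v \in probe s
   | inl (inr (s, t)), inl (inr (r, v)) => (r == s) && (v \in rd_bag t)
   | inr (s, q), inl (inl (_, v)) => v \in probe s
   | inr (s, q), inl (inr (r, v)) => (r == s) && (v \in probe q)
   | inr sq, inr ro => ro == sq
   | _, _ => false
   end].

Lemma step_dec_edge (x y : step_graph) : edge x y ->
  exists t, (x \in step_bag t) && (y \in step_bag t).
Proof.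
case: x y => [[[r u]|[r u]]|[r o]] [[[r' v]|[r' v]]|[r' o']] //=.
- move=> /andP[_ /(rd_edge (bdec B))[t uvt]].
  by exists (inl (inl t)); rewrite !inE.
- move=> /andP[/eqP <- /(rd_edge (bdec B))[t uvt]].
  by exists (inl (inr (r, t))); rewrite !inE eqxx.
- move=> /andP[/eqP <- uo].
  by exists (inr (r, o')); rewrite !inE !eqxx uo.
- move=> /andP[/eqP -> vo].
  by exists (inr (r, o)); rewrite !inE !eqxx vo.
Qed.

Definition step_top (x : step_graph) : step_tree :=
  match (x : step_vertex) with
  | inl (inl (_, v)) => inl (inl (rd_top (bdec B) v))
  | inl (inr (s, v)) => inl (inr (s, rd_top (bdec B) v))
  | inr sq => inr sq
  end.

Lemma step_top_bag x : x \in step_bag (step_top x).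
Proof.
by case: x => [[[r u]|[r u]]|[r o]]; rewrite inE /= ?eqxx ?rd_top_bag.
Qed.

Lemma step_parent_bag x (t : step_tree) : x \in step_bag t -> t != step_top x ->
  (t != tree_root) && (x \in step_bag (parent t)).
Proof.
have home_bag s := subsetP (probe_home (b := B) s).
case: x t => [[[r u]|[r u]]|[r o]] [[t|[s t]]|[s q]]; rewrite !inE //=.
- move=> ut t_top.
  have /(rd_parent_bag ut)/andP[tr up] : t != rd_top (bdec B) u.
    by apply: contraNneq t_top => ->.
  by rewrite up andbT; apply: contraNneq tr => -[->].
- by move=> us _; case: eqVneq => //= _; rewrite home_bag.
- move=> /andP[/eqP -> ut] t_top.
  have /(rd_parent_bag ut)/andP[/negPf tr up] : t != rd_top (bdec B) u.
    by apply: contraNneq t_top => ->.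
  by rewrite tr /= eqxx.
- by move=> /andP[-> /home_bag].
- by move=> /eqP ->; rewrite eqxx.
Qed.

Definition step_dec :=
  RootedDec step_dec_edge step_top_bag step_parent_bag.

(** Outside the main tree, the main vertices of a bag lie in copies of a probe, hence are isolated
    in the bag. At a leaf all edges meet the apex. *)
Lemma step_dec_bipartite (t : step_dec) : exists c : step_graph -> bool,
  forall x y, x \in rd_bag t -> y \in rd_bag t -> edge x y -> c x != c y.
Proof.
case: t => [[t|[s t]]|[s q]].
- have [c c_proper] := bdec_bipartite (t : bdec B).
  exists (fun x : step_vertex =>
    if x is inl (inl (_, v)) then c v else false) => x y.
  rewrite !inE.
  case: x y => [[[r u]|[r u]]|[r o]] [[[r' v]|[r' v]]|[r' o']] //=.
  by move=> ut vt /andP[_]; apply: c_proper.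
- have [c c_proper] := bdec_bipartite (t : bdec B).
  exists (fun x : step_vertex =>
    if x is inl (inr (_, v)) then c v else false) => x y.
  rewrite !inE.
  case: x y => [[[r u]|[r u]]|[r o]] [[[r' v]|[r' v]]|[r' o']] //=.
    move=> us vs /andP[_ uv].
    by case/negP: (independentP _ (probe_independent s) _ _ us vs).
  by move=> /andP[_ ut] /andP[_ vt] /andP[_]; apply: c_proper.
- exists (fun x : step_vertex => if x is inr _ then true else false) => x y.
  rewrite !inE.
  case: x y => [[[r u]|[r u]]|[r o]] [[[r' v]|[r' v]]|[r' o']] //=.
    move=> us vs /andP[_ uv].
    by case/negP: (independentP _ (probe_independent s) _ _ us vs).
  move=> /andP[_ us] /andP[_ vs] /andP[_ uv].
  by case/negP: (independentP _ (probe_independent q) _ _ us vs).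
Qed.

Definition step_home (i : P * P * bool) : step_dec := inr i.1.

Lemma step_probe_home i : step_probe i \subset rd_bag (step_home i).
Proof.
case: i => [[s q] b]; apply/subsetP => x; rewrite !inE.
case: x => [[[r u]|[r u]]|[r o]] /=; first by case/andP.
  by case/and3P=> _ -> ->.
by case/andP.
Qed.

Definition burling_step := BurlingGraph step_probe_independent step_probe_hits
  step_dec_bipartite step_probe_home.
End BurlingStep.

(** * Iterating the step, and counting vertices and probes *)

Definition unit_tree : rooted_tree.
Proof. by apply: (@RootedTree unit tt id (fun=> 0)) => -[]. Defined.

Definition unit_dec : rooted_dec unit_graph.
Proof.
by apply: (@RootedDec unit_graph unit_tree (fun=> setT) _ (fun=> tt))
  => // -[] [].
Defined.

Definition burling_base : burling_graph.
Proof.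
apply: (@BurlingGraph unit_graph unit (fun=> setT) _ _ unit_dec _ (fun=> tt)).
- by move=> _; apply/independentP.
- move=> I _; case: (set_0Vmem I) => [->|[x xI]]; first by rewrite cards0.
  rewrite (leq_trans (max_card _)) // card_unit card_gt0.
  apply/set0Pn; exists tt; rewrite inE.
  by apply/set0Pn; exists x; rewrite setTI.
- by move=> t; exists xpredT.
- by [].
Defined.

Definition burling k := iter k burling_step burling_base.

(** A step replaces [p] by [2 p^2], so [2 p] is squared. *)
Lemma card_burling_probe k : 2 * #|probe_index (burling k)| = 2 ^ 2 ^ k.
Proof.
elim: k => [|k IHk] /=; first by rewrite card_unit.
by rewrite !card_prod card_bool expnSr expnM -IHk -mulnn; ring.
Qed.

(** A step replaces [n] vertices by [2 p n + p^2] and [p] probes by [2 p^2], so the ratio of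
    vertices to probes grows by 1/2. *)
Lemma card_burling k : 2 * #|burling k| = (k + 2) * #|probe_index (burling k)|.
Proof.
elim: k => [|k IHk]; first by rewrite /= !card_unit.
rewrite [burling k.+1]/= /= !card_sum !card_prod card_bool.
have -> : 2 * (#|probe_index (burling k)| * #|burling k| +
    #|probe_index (burling k)| * #|burling k| +
    #|probe_index (burling k)| * #|probe_index (burling k)|) =
  #|probe_index (burling k)| * (2 * (2 * #|burling k|)) +
    2 * #|probe_index (burling k)| * #|probe_index (burling k)| by ring.
by rewrite IHk; ring.
Qed.

Lemma alpha_burling k : alpha (burling k) <= #|probe_index (burling k)|.
Proof.
apply/bigmax_leqP => I /probe_hits /leq_trans; apply; exact: max_card.
Qed.

(** * The join with an independent set *)

Section Join.
Variable G : sgraph.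

Definition join_edge : rel (G + G) := fun x y =>
  match x, y with
  | inl u, inl v => edge u v
  | inr _, inr _ => false
  | _, _ => true
  end.

Lemma join_edge_sym : symmetric join_edge.
Proof. by move=> [u|u] [v|v] //=; rewrite edge_sym. Qed.

Lemma join_edge_irr : irreflexive join_edge.
Proof. by move=> [u|u] //=; rewrite edge_irr. Qed.

Definition join_graph := SGraph join_edge_sym join_edge_irr.

Definition star_parent (x : option G) : option G := None.

Definition star_depth (x : option G) : nat := isSome x.

Lemma star_depth_parent x :
  x != None -> star_depth (star_parent x) < star_depth x.
Proof. by case: x. Qed.

Definition star := RootedTree star_depth_parent.

Definition star_bag (t : star) : {set join_graph} :=
  [set x : G + G | if x is inr v then t == Some v else true].

Lemma star_edge (x y : join_graph) : edge x y ->
  exists t, (x \in star_bag t) && (y \in star_bag t).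
Proof.
case: x y => [u|u] [v|v] //= _.
- by exists None; rewrite !inE.
- by exists (Some v); rewrite !inE eqxx.
- by exists (Some u); rewrite !inE eqxx.
Qed.

Definition star_top (x : join_graph) : star :=
  if (x : G + G) is inr v then Some v else None.

Lemma star_top_bag x : x \in star_bag (star_top x).
Proof. by case: x => u; rewrite inE /=. Qed.

Lemma star_parent_bag x (t : star) : x \in star_bag t -> t != star_top x ->
  (t != tree_root) && (x \in star_bag (parent t)).
Proof.
by case: x => u; rewrite !inE /=; [move=> _ ->|move=> /eqP ->; rewrite eqxx].
Qed.

Definition star_dec := RootedDec star_edge star_top_bag star_parent_bag.

Lemma card_star_bag (t : star) : #|star_bag t| <= #|G|.+1.
Proof.
(* A bag has at most one vertex of the form [inr v], so sending it to [None] is injective on the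
   bag. *)
pose h (x : join_graph) : option G :=
  if (x : G + G) is inl v then Some v else None.
rewrite -card_option -(card_in_imset (f := h)) ?max_card //.
by move=> [u|u] [v|v]; rewrite !inE //=;
  [move=> _ _ [->]|move=> /eqP -> /eqP[->]].
Qed.

Lemma tw_join : 0 < #|G| -> tw join_graph = Posz #|G|.
Proof.
move=> G_gt0; rewrite /tw; set m := td_min _.
have m_le : m <= #|G|.+1 by apply: (td_min_le (D := star_dec)) card_star_bag.
have m_gt : #|G| < m.
  apply: min_degree_td_min => [|[u|u]].
  - by rewrite card_sum addn_gt0 G_gt0.
  - rewrite -(card_imset _ (@inr_inj G G)) subset_leq_card //.
    by apply/subsetP => _ /imsetP[v _ ->]; rewrite inE.
  - rewrite -(card_imset _ (@inl_inj G G)) subset_leq_card //.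
    by apply/subsetP => _ /imsetP[v _ ->]; rewrite inE.
have -> : m = #|G|.+1 by apply/eqP; rewrite eqn_leq m_le.
by rewrite intS GRing.addrC GRing.addKr.
Qed.

(** A vertex [inr v] is adjacent to all of [G], so an independent subset of a bag is a singleton or
    lies in [G]. *)
Lemma tree_alpha_join : tree_alpha join_graph <= maxn 1 (alpha G).
Proof.
apply: (td_min_le (D := star_dec)) => t; apply: alpha_induced_le => I It indI.
have [[v vI]|noI] := pselect (exists v, (inr v : join_graph) \in I).
  have vt : t == Some v by have := subsetP It _ vI; rewrite inE.
  apply: leq_trans (leq_maxl _ _); rewrite -(cards1 (inr v : join_graph)).
  apply/subset_leq_card/subsetP => -[u|u] uI; rewrite inE.
    by have := independentP _ indI _ _ uI vI.
  by have := subsetP It _ uI; rewrite inE (eqP vt) => /eqP[->].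
apply: leq_trans (leq_maxr _ _).
pose J := [set u | (inl u : join_graph) \in I].
have -> : I = inl @: J.
  apply/setP => -[u|u]; last first.
    have /negPf -> : (inr u : join_graph) \notin I.
      by apply/negP => uI; apply: noI; exists u.
    by symmetry; apply/negbTE/imsetP => -[].
  by rewrite (mem_imset _ _ (@inl_inj G G)) inE.
rewrite (card_imset _ (@inl_inj G G)); rewrite /alpha.
apply: (@leq_bigmax_cond _ (@independent G) (fun S => #|S|) J).
apply/independentP => u v; rewrite !inE => uI vI.
exact: (independentP _ indI _ _ uI vI).
Qed.

Variable D : rooted_dec G.

Definition join_bag (t : D) : {set join_graph} :=
  [set x : G + G | if x is inl v then v \in rd_bag t else true].

Lemma join_dec_edge (x y : join_graph) : edge x y ->
  exists t, (x \in join_bag t) && (y \in join_bag t).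
Proof.
case: x y => [u|u] [v|v] //=.
- by move=> /(rd_edge D)[t uvt]; exists t; rewrite !inE.
- by move=> _; exists (rd_top D u); rewrite !inE rd_top_bag.
- by move=> _; exists (rd_top D v); rewrite !inE rd_top_bag.
Qed.

Definition join_top (x : join_graph) : D :=
  if (x : G + G) is inl v then rd_top D v else tree_root.

Lemma join_top_bag x : x \in join_bag (join_top x).
Proof. by case: x => u; rewrite inE //= rd_top_bag. Qed.

Lemma join_parent_bag x (t : D) : x \in join_bag t -> t != join_top x ->
  (t != tree_root) && (x \in join_bag (parent t)).
Proof. by case: x => u; rewrite !inE; [apply: rd_parent_bag|move=> _ ->]. Qed.

Definition join_dec := RootedDec join_dec_edge join_top_bag join_parent_bag.

Lemma tree_chi_join :
    (forall t : D, exists c : G -> bool,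
      forall x y, x \in rd_bag t -> y \in rd_bag t -> edge x y -> c x != c y) ->
  tree_chi join_graph <= 3.
Proof.
move=> bip; apply: (td_min_le (D := join_dec)) => t.
have [c c_proper] := bip t.
(* Colours 0 and 1 serve the bag of [D], and the third serves the added independent set. *)
apply: (@chi_induced_le _ _ _ (fun x : join_graph =>
  if (x : G + G) is inl v then inord (c v) else ord_max)) => x y.
have c_lt u : c u < 3 by case: (c u).
rewrite !inE -val_eqE; case: x y => [u|u] [v|v] //=; rewrite ?inordK //.
- by move=> ut vt /(c_proper _ _ ut vt); case: (c u); case: (c v).
- by case: (c u).
- by case: (c v).
Qed.
End Join.

(* Logarithmic estimate and choice of parameters *)
From mathcomp Require Import classical_sets reals topology normedtype.
From mathcomp Require Import sequences landau exp.
Import Order.TTheory GRing.Theory Num.Theory.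
Import numFieldNormedType.Exports.
Local Open Scope ring_scope.

Lemma ln_ln_card_burling (R : realType) k :
  ln (ln #|burling k|%:R) <= k.+1%:R :> R.
Proof.
have ln2 : ln 2 <= 1 :> R by apply: le_ln1Dx; rewrite (lt_trans (ltrN10 R)).
have card_le : (#|burling k| <= 2 ^ 2 ^ k.+1)%N.
  (* Here [4 |H| = (k + 2) 2^(2^k)], and [k + 2 <= 2^(2^k)]. *)
  apply: (@leq_trans (2 * (2 * #|burling k|))).
    by rewrite mulnA leq_pmull.
  rewrite card_burling mulnCA card_burling_probe expnSr expnM -mulnn.
  rewrite leq_mul2r addn2 orbC.
  have k_lt : (k < 2 ^ k)%N by apply: ltn_expl.
  have pow_lt : (2 ^ k < 2 ^ 2 ^ k)%N by apply: ltn_expl.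
  by rewrite (leq_ltn_trans k_lt pow_lt).
(* [ln] takes the value 0 at non-positive arguments. *)
have [lt0|gt0] := leP (ln #|burling k|%:R) (0 : R); first by rewrite ln0.
have card_gt0 : 0 < #|burling k|%:R :> R.
  by rewrite lt0r ler0n andbT; apply: contraTneq gt0 => ->; rewrite ln0 ?ltxx.
apply: (@le_trans _ _ (ln (2 ^+ k.+1))).
  rewrite ler_ln ?posrE ?exprn_gt0 //.
  apply: (@le_trans _ _ (ln ((2 ^ 2 ^ k.+1)%:R))).
    by rewrite ler_ln ?posrE ?ler_nat // ltr0n expn_gt0.
  by rewrite natrX lnXn // -[leLHS]mulr_natl natrX ler_piMr ?exprn_ge0.
by rewrite lnXn // -[leLHS]mulr_natl ler_piMr.
Qed.

Theorem theorem3p5 (R : realType) (f g : R -> R)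
    (f_gt0 : forall x : R, 0 < f x) (g_gt0 : forall x : R, 0 < g x)
    (g_littleo : g =o_ (pinfty_nbhs R) (fun x : R => ln (ln x))) :
  exists G : sgraph,
    (tw G)%:~R >
      (tree_alpha G)%:R * f ((tree_chi G)%:R) * g ((tw G)%:~R).
Proof.
(* Only the bound 3 on tree-chi is known, so [F] dominates [f] at 0, 1, 2 and 3. *)
pose F := \sum_(i < 4) f i%:R.
have F_gt0 : 0 < F.
  apply: (lt_le_trans (f_gt0 0)); rewrite /F big_ord_recl lerDl.
  by apply: sumr_ge0 => i _; apply: ltW.
(* With this constant the right-hand side is at most [p (k + 1) / 2], just below
   [|H| = p (k + 2) / 2]. *)
have eps_gt0 : 0 < (2 * F)^-1 by rewrite invr_gt0 mulr_gt0.
have [M [_ g_le]] := (eqoP _ _ _).1 g_littleo _ eps_gt0.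
(* As [|H| >= (k + 2) / 2], this puts [|H|] beyond [M], where the little-o bound holds, and beyond
   [e], where [ln (ln |H|)] is positive and equals its norm. *)
pose k := (2 * Num.truncn (`|M| + expR 1)).+1.
pose W := #|burling k|; pose p := #|probe_index (burling k)|.
have p_gt0 : (0 < p)%N.
  by rewrite -(@ltn_pmul2l 2) // muln0 card_burling_probe expn_gt0.
have W_eq : (2 * W = (k + 2) * p)%N := card_burling k.
have W_gt : `|M| + expR 1 < W%:R.
  apply: (lt_le_trans (truncnS_gt _)); rewrite ler_nat -(@leq_pmul2l 2) // W_eq.
  by rewrite (leq_trans _ (leq_pmulr _ p_gt0)) // /k mulnS addn2 !ltnS leqW.
have expW : expR 1 < W%:R :> R by apply: le_lt_trans W_gt; rewrite lerDr.
have lnW : 1 < ln W%:R :> R.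
  by rewrite -[ltLHS]expRK ltr_ln ?posrE ?expR_gt0 // (lt_trans (expR_gt0 1)).
have W_gt0 : (0 < W)%N by rewrite -(ltr0n R) (lt_trans (expR_gt0 1)).
have gW : g W%:R <= (2 * F)^-1 * k.+1%:R.
  apply: le_trans (ler_norm _) _; apply: le_trans (g_le _ _) _.
    apply: le_lt_trans W_gt.
    by rewrite (le_trans (ler_norm _)) // lerDl expR_ge0.
  by rewrite ler_pM2l // ger0_norm ?ln_ln_card_burling // ltW // ln_gt0.
exists (join_graph (burling k)); rewrite tw_join //.
have chi3 := tree_chi_join (@bdec_bipartite (burling k)).
have fF : f (tree_chi (join_graph (burling k)))%:R <= F.
  rewrite /F (bigD1 (Ordinal (chi3 : (_ < 4)%N))) //= lerDl.
  by apply: sumr_ge0 => i _; apply: ltW.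
have alpha_p : (tree_alpha (join_graph (burling k)) <= p)%N.
  apply: leq_trans (tree_alpha_join _) _.
  by rewrite geq_max p_gt0 alpha_burling.
apply: (@le_lt_trans _ _ (p%:R * F * ((2 * F)^-1 * k.+1%:R))).
  by rewrite ler_pM ?mulr_ge0 ?ler_pM ?ler_nat // ltW.
have -> : p%:R * F * ((2 * F)^-1 * k.+1%:R) = p%:R * k.+1%:R / 2.
  by field; rewrite gt_eqF.
rewrite ltr_pdivrMr // mulrC -natrM -[2]/(2%:R) -[ltRHS]natrM ltr_nat mulnC.
by rewrite [X in (_ < X)%N]mulnC W_eq mulnC ltn_pmul2r // addn2.
Qed.
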